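(* Let $\Phi$ be a root system of rank at least $2$ with positive system $\Phi^+$ and Weyl group $W$, and let $\rho\colon E\to L=L_{\Phi^+}(W)$ be the defining characteristic map of its punctured Weyl group. A subset of $E_0=\Phi^+$ is closed for the $L$-action (i.e. for the closure operator $\mathrm{cl}_\rho$) if and only if it is convex; that is, $\mathrm{cl}_\rho=\mathrm{cone}_{\mathbb{R}}$.
   Context: A root system $\Phi$ in a finite-dimensional real Euclidean space $V$ is a finite spanning set of nonzero vectors such that for every $\alpha\in\Phi$: $\mathbb{R}\alpha\cap\Phi=\{\alpha,-\alpha\}$, and $s_\alpha(\Phi)=\Phi$, where $s_\alpha(v)=v-\frac{2(v,\alpha)}{(\alpha,\alpha)}\alpha$. Its rank is $\dim V$, and its Weyl group $W$ is the group generated by all $s_\alpha$. A positive system $\Phi^+$ is the set of elements of $\Phi$ that are positive for some total ordering of $V$ compatible with addition and scalar multiplication. For $A\subseteq\Phi^+$, $\mathrm{cone}_{\mathbb{R}}(A)=\mathbb{R}_{\ge0}A\cap\Phi^+$, where $\mathbb{R}_{\ge0}A$ is the set of linear combinations of elements of $A$ with nonnegative real coefficients; $A$ is convex if $\mathrm{cone}_{\mathbb{R}}(A)=A$. Let $E$ be the nerve of the groupoid with object set $\Phi^+$ and one morphism $\alpha\xrightarrow{w}w(\alpha)$ for each $w\in W$, $\alpha\in\Phi^+$ with $w(\alpha)\in\Phi^+$. There is a map $E\to BW$ to the nerve of $W$ recording the group elements; $L_{\Phi^+}(W)\subseteq BW$ is its image (the punctured Weyl group) and $\rho\colon E\to L_{\Phi^+}(W)$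 the induced map. Thus the $n$-simplices of $L$ are the tuples $[w_1|\cdots|w_n]\in BW_n=W^n$ for which there is $\alpha\in\Phi^+$ with $w_i\cdots w_1(\alpha)\in\Phi^+$ for all $1\le i\le n$. For an $n$-simplex $f$ of $L$, its domain $\mathrm{D}(f)\subseteq E_0=\Phi^+$ is the set of $\alpha$ for which there is a simplex of $E_n$ with initial vertex $\alpha$ mapping to $f$. The closure operator on $E_0$ is $\mathrm{cl}_\rho(A)=\bigcap_{f:\,A\subseteq\mathrm{D}(f)}\mathrm{D}(f)$, over all simplices $f$ of $L$ of all dimensions. *)

(* Defs.v *)
From mathcomp Require Import all_boot all_order all_algebra finmap.
From mathcomp Require Import boolp classical_sets reals.

Set Implicit Arguments.
Unset Strict Implicit.
Unset Printing Implicit Defensive.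

Import Order.TTheory GRing.Theory Num.Theory.

Local Open Scope ring_scope.
Local Open Scope classical_set_scope.

(** A Euclidean space is a finite-dimensional [V : vectType R] over a
    [realType] with a positive definite symmetric form
    [ip : {dot V for idfun}]. *)

Definition reflection (R : realType) (V : vectType R)
    (ip : {dot V for idfun}) (a v : V) : V :=
  v - (2 * ip v a / ip a a) *: a.

Record root_system (R : realType) (V : vectType R)
    (ip : {dot V for idfun}) (Phi : {fset V}) : Prop := {
  root_system_span : (<<Phi>> = fullv)%VS;
  root_system_neq0 : forall a, a \in Phi -> a != 0;
  root_system_line : forall a, a \in Phi ->
    [set v | exists c : R, v = c *: a] `&` [set` Phi] = [set a; - a];
  root_system_refl : forall a, a \in Phi ->
    reflection ip a @` [set` Phi] = [set` Phi]
}.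

(** The subgroup of the group of bijections of [V] generated by the
    reflections in the roots. *)
Inductive weyl (R : realType) (V : vectType R) (ip : {dot V for idfun})
    (Phi : {fset V}) : set (V -> V) :=
| weyl_refl a : a \in Phi -> weyl ip Phi (reflection ip a)
| weyl_id : weyl ip Phi idfun
| weyl_comp g h : weyl ip Phi g -> weyl ip Phi h -> weyl ip Phi (g \o h)
| weyl_inv g h : weyl ip Phi g -> cancel g h -> cancel h g -> weyl ip Phi h.

Record compatible_order (R : realType) (V : vectType R) (le : rel V) : Prop := {
  compatible_order_total : total le;
  compatible_order_anti : antisymmetric le;
  compatible_order_trans : transitive le;
  compatible_order_add : forall x y z, le x y -> le (x + z) (y + z);
  compatible_order_scale : forall (c : R) x y,
    0 <= c -> le x y -> le (c *: x) (c *: y)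
}.

Definition positive_system (R : realType) (V : vectType R)
    (Phi : {fset V}) (Pos : set V) : Prop :=
  exists2 le : rel V, compatible_order le &
    Pos = [set a | [/\ a \in Phi, a != 0 & le 0 a]].

Definition nonneg_span (R : realType) (V : vectType R) (A : set V) : set V :=
  [set v | exists n (a : 'I_n -> V) (c : 'I_n -> R),
     [/\ forall i, A (a i), forall i, 0 <= c i & v = \sum_i c i *: a i]].

Definition cone (R : realType) (V : vectType R) (Pos A : set V) : set V :=
  nonneg_span A `&` Pos.

Definition convex_roots (R : realType) (V : vectType R)
    (Pos A : set V) : Prop :=
  cone Pos A = A.

(** The [n]-simplices of [E]: chains of [n] composable morphisms
    [x_0 -w_1-> x_1 -w_2-> ... -w_n-> x_n] between positive roots, given by
    their vertices and labels.  The index [i : 'I_n] stands for the arrow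
    [w_(i+1)] from [x_i] to [x_(i+1)]. *)
Definition nerve_E (R : realType) (V : vectType R) (ip : {dot V for idfun})
    (Phi : {fset V}) (Pos : set V) (n : nat) :
    set (('I_n.+1 -> V) * ('I_n -> V -> V)) :=
  [set e | [/\ forall i, Pos (e.1 i),
               forall i, weyl ip Phi (e.2 i) &
               forall i : 'I_n,
                 e.2 i (e.1 (widen_ord (leqnSn n) i)) = e.1 (lift ord0 i)]].

Definition initial_vertex (V : Type) (n : nat)
    (e : ('I_n.+1 -> V) * ('I_n -> V -> V)) : V :=
  e.1 ord0.

(** The map from [E] to the nerve of [W], whose [n]-simplices are the
    families of [n] elements of [W]. *)
Definition rho (V : Type) (n : nat)
    (e : ('I_n.+1 -> V) * ('I_n -> V -> V)) : 'I_n -> V -> V :=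
  e.2.

Definition punctured_weyl (R : realType) (V : vectType R)
    (ip : {dot V for idfun}) (Phi : {fset V}) (Pos : set V) (n : nat) :
    set ('I_n -> V -> V) :=
  @rho V n @` nerve_E ip Phi Pos (n := n).

Definition domain (R : realType) (V : vectType R) (ip : {dot V for idfun})
    (Phi : {fset V}) (Pos : set V) (n : nat) (f : 'I_n -> V -> V) : set V :=
  @initial_vertex V n @` (nerve_E ip Phi Pos (n := n) `&` @rho V n @^-1` [set f]).

(** The intersection is taken inside [E_0 = Pos]. *)
Definition cl_rho (R : realType) (V : vectType R) (ip : {dot V for idfun})
    (Phi : {fset V}) (Pos A : set V) : set V :=
  [set x | Pos x /\
     forall n (f : 'I_n -> V -> V), punctured_weyl ip Phi Pos f ->
       A `<=` domain ip Phi Pos f -> domain ip Phi Pos f x].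

Definition closed_for_action (R : realType) (V : vectType R)
    (ip : {dot V for idfun}) (Phi : {fset V}) (Pos A : set V) : Prop :=
  cl_rho ip Phi Pos A = A.

(* Main.v *)
(** A domain is [Pos] intersected with finitely many translates of [Pos] by
    Weyl group elements, hence convex; this gives one inclusion.  Conversely,
    if [b] is a positive root outside the cone of [A], Gordan's alternative
    provides [l] that is positive on [A] and negative at [b].  Choosing [w] to
    maximize [ip (w l) m], where [m] is positive on [Pos], makes [w l]
    nonnegative on [Pos], so that [w] maps [A] into [Pos] but not [b]: the
    domain of the 1-simplex [w] separates [b] from [A].  Rank at least 2 is
    needed only for empty [A], to replace it by a singleton whose cone avoids
    [b], because simplices must have nonempty domain. *)

Require Import Defs.
From mathcomp Require Import all_boot all_order all_algebra finmap.
From mathcomp Require Import boolp classical_sets reals.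
From mathcomp Require Import ring lra.

Set Implicit Arguments.
Unset Strict Implicit.
Unset Printing Implicit Defensive.

Import Order.TTheory GRing.Theory Num.Theory.

Local Open Scope ring_scope.
Local Open Scope classical_set_scope.

(** * Gordan's alternative for finite families in a convex cone *)

Lemma perturb_gt0 (R : realFieldType) (T : eqType) (f g : T -> R) (s : seq T) :
  {in s, forall x, 0 < f x} ->
  exists2 e : R, 0 < e & {in s, forall x, 0 < f x + e * g x}.
Proof.
elim: s => [|a s IHs] fs; first by exists 1.
have [x xs|e e0 es] := IHs; first by apply: fs; rewrite inE xs orbT.
have fa : 0 < f a by apply: fs; rewrite inE eqxx.
(* The second bound gives [d * |g a| < f a]. Shrinking [e] to [d] is harmless on [s]: where [g] is
   negative, a smaller multiple only increases the sum. *)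
pose d := Num.min e (f a / (`|g a| + 1)).
have ga0 : 0 < `|g a| + 1 by rewrite ltr_wpDl.
have d0 : 0 < d by rewrite lt_min e0 divr_gt0.
exists d => // x; rewrite inE => /predU1P[->|xs].
  have : d * (`|g a| + 1) <= f a by rewrite -ler_pdivlMr // ge_min lexx orbT.
  have : - (d * g a) <= d * `|g a|.
    by rewrite -mulrN ler_pM2l // -normrN ler_norm.
  by nra.
have fx : 0 < f x by apply: fs; rewrite inE xs orbT.
have ex := es _ xs.
have de : d <= e by rewrite ge_min lexx.
have [gx|gx] := leP 0 (g x); first by rewrite ltr_pwDl // mulr_ge0 // ltW.
by apply: lt_le_trans ex _; rewrite lerD2l ler_nM2r.
Qed.

Lemma dot_sym (R : numDomainType) (V : lmodType R) (ip : {dot V for idfun})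
  (u v : V) : ip u v = ip v u.
Proof. by rewrite hermC /= expr0 mul1r. Qed.

(* Given [x] positive on all of [s] but nonpositive on the remaining vector
   [a], push [s] along [a] into the orthogonal of [x], separate there, and
   correct the result by a multiple of [x] to make it orthogonal to [a]. *)
Lemma gordan (R : realFieldType) (V : lmodType R) (ip : {dot V for idfun})
    (P : set V) :
  (forall u v, P u -> P v -> P (u + v)) ->
  (forall (c : R) u, 0 < c -> P u -> P (c *: u)) ->
  ~ P 0 ->
  forall s : seq V, {in s, forall v, P v} ->
  exists x, {in s, forall v, 0 < ip x v}.
Proof.
move=> PD PZ P0 s; have [n] := ubnP (size s).
elim: n s => // n IHn [|a s] sn sP; first by exists 0.
have Ps v : v \in s -> P v by move=> vs; apply: sP; rewrite inE vs orbT.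
have Pa : P a by apply: sP; rewrite inE eqxx.
have a0 : 0 < ip a a.
  by apply: neq0_dnorm_gt0; apply: contra_not_neq P0 => <-.
have [//|x xs] := IHn s sn.
have [xa|xa] := ltP 0 (ip x a).
  by exists x => v; rewrite inE => /predU1P[->|/xs].
suff [z za zs] : exists2 z, ip z a = 0 & {in s, forall v, 0 < ip z v}.
  have [e e0 es] := perturb_gt0 (ip a) zs.
  exists (z + e *: a) => v; rewrite linearDl /= linearZl_LR /= inE.
  by move=> /predU1P[->|/es//]; rewrite za add0r mulr_gt0.
move: xa; rewrite le_eqVlt => /predU1P[xa|xa]; first by exists x.
pose t v := - (ip x v / ip x a).
have [||y ys] := IHn [seq v + t v *: a | v <- s]; first by rewrite size_map.
  move=> _ /mapP[v vs ->]; apply: PD; first exact: Ps.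
  by apply: PZ => //; rewrite oppr_gt0 pmulr_rlt0 ?invr_lt0 // xs.
exists (y - (ip y a / ip x a) *: x).
  by rewrite linearBl /= linearZl_LR /= divfK ?subrr // lt_eqF.
move=> v vs; have := ys _ (map_f _ vs).
rewrite linearBl /= linearZl_LR /= linearDr /= linearZr_LR /= /t.
by congr (0 < _); ring.
Qed.

(** * Nonnegative spans *)

Section NonnegSpan.
Variables (R : realType) (V : vectType R) (A : set V).

Lemma nonneg_spanD u v :
  nonneg_span A u -> nonneg_span A v -> nonneg_span A (u + v).
Proof.
move=> [n [a [c [aA c0 ->]]]] [p [b [d [bA d0 ->]]]].
exists (n + p)%N.
exists (fun i => match split i with inl j => a j | inr j => b j end).
exists (fun i => match split i with inl j => c j | inr j => d j end).
split=> [i|i|]; try by case: split.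
rewrite big_split_ord /=; congr (_ + _); apply: eq_bigr => i _.
  by rewrite (unsplitK (inl _ i)).
by rewrite (unsplitK (inr _ i)).
Qed.

Lemma nonneg_spanZ (k : R) u :
  0 <= k -> nonneg_span A u -> nonneg_span A (k *: u).
Proof.
move=> k0 [n [a [c [aA c0 ->]]]]; exists n, a, (fun i => k * c i).
split=> // [i|]; first by rewrite mulr_ge0.
by rewrite scaler_sumr; apply: eq_bigr => i _; rewrite scalerA.
Qed.

Lemma nonneg_span_sub : A `<=` nonneg_span A.
Proof.
move=> a aA; exists 1%N, (fun=> a), (fun=> 1).
by split=> //; rewrite big_ord1 scale1r.
Qed.

Lemma nonneg_span0 : nonneg_span A 0.
Proof.
exists 0%N, (fun=> 0), (fun=> 0).
by rewrite big_ord0; split=> // -[].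
Qed.

End NonnegSpan.

(** * Total orders compatible with the vector space structure *)

Section CompatibleOrder.
Variables (R : realType) (V : vectType R) (le : rel V).
Hypothesis lec : compatible_order le.

Let lexx x : le x x.
Proof. by have := compatible_order_total lec x x; rewrite orbb. Qed.

Lemma compatible_order_ge0D u v : le 0 u -> le 0 v -> le 0 (u + v).
Proof.
move=> u0 v0; apply: (compatible_order_trans lec) v0 _.
by have := compatible_order_add lec v u0; rewrite add0r.
Qed.

Lemma compatible_order_ge0Z (c : R) u : 0 <= c -> le 0 u -> le 0 (c *: u).
Proof. by move=> c0 /(compatible_order_scale lec c0); rewrite scaler0. Qed.

Lemma compatible_order_ge0_sum n (c : 'I_n -> R) (a : 'I_n -> V) :
  (forall i, 0 <= c i) -> (forall i, le 0 (a i)) -> le 0 (\sum_i c i *: a i).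
Proof.
move=> c0 a0; apply: (big_ind (fun v => le 0 v)) => //.
  exact: compatible_order_ge0D.
by move=> i _; apply: compatible_order_ge0Z.
Qed.

(** Pointedness of the nonnegative half: it keeps 0 out of the cones to which [gordan] is
    applied. *)
Lemma compatible_order_ge0N v : le 0 v -> le 0 (- v) -> v = 0.
Proof.
move=> v0 /(compatible_order_add lec v); rewrite add0r addNr => v0'.
by apply: (compatible_order_anti lec); rewrite v0'.
Qed.

Lemma compatible_order_gt0N v : ~~ le 0 v -> le 0 (- v).
Proof.
move=> v0; have := compatible_order_total lec 0 v; rewrite (negbTE v0) /=.
by move=> /(compatible_order_add lec (- v)); rewrite subrr add0r.
Qed.

End CompatibleOrder.

(** * The Weyl group acting on roots *)

Section Weyl.
Variables (R : realType) (V : vectType R) (ip : {dot V for idfun}).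
Variable Phi : {fset V}.
Hypothesis Phi_root : root_system ip Phi.

Lemma root_opp (a : V) : a \in Phi -> - a \in Phi.
Proof.
move=> aPhi; have /seteqP[_ /(_ (- a))] := root_system_line Phi_root aPhi.
by case; first by right.
Qed.

Lemma root_gt0 a : a \in Phi -> 0 < ip a a.
Proof. by move=> /(root_system_neq0 Phi_root); exact: neq0_dnorm_gt0. Qed.

Lemma reflection_linear a : linear (reflection ip a).
Proof.
move=> k u v; rewrite /reflection linearDl /= linearZl_LR /=.
rewrite scalerBr scalerA addrACA -opprD -scalerDl; congr (_ - _ *: _).
by ring.
Qed.

Lemma reflection_isometry a : a \in Phi ->
  forall u v, ip (reflection ip a u) (reflection ip a v) = ip u v.
Proof.
move=> /root_gt0 a0 u v; rewrite /reflection.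
rewrite !(linearBl, linearBr) /= !(linearZl_LR, linearZr_LR) /=.
rewrite (dot_sym ip a v); have {}a0 := lt0r_neq0 a0.
by field.
Qed.

(** Elements of [weyl] are bare functions, so all three properties are carried together through the
    generation, inverses included. *)
Lemma weyl_properties w : weyl ip Phi w ->
  [/\ linear w, forall u v, ip (w u) (w v) = ip u v &
      w @` [set` Phi] = [set` Phi]].
Proof.
elim=> {w} [a aPhi||g h _ [gl gi gP] _ [hl hi hP]|g h _ [gl gi gP] gh hg].
- split; [exact: reflection_linear|exact: reflection_isometry|].
  exact: root_system_refl.
- by split=> //; rewrite image_id.
- split=> [k u v|u v|]; [by rewrite /= hl gl|by rewrite /= gi hi|].
  by rewrite -image_comp hP gP.
- split=> [k u v|u v|].
  + by apply: (can_inj gh); rewrite hg gl !hg.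
  + by rewrite -gi !hg.
  + rewrite -{1}gP image_comp; apply/seteqP; split=> x.
      by move=> [y yP <-] /=; rewrite gh.
    by move=> xP; exists x => //=; rewrite gh.
Qed.

Lemma weyl_root w a : weyl ip Phi w -> a \in Phi -> w a \in Phi.
Proof.
move=> /weyl_properties[_ _ wP] aPhi.
by have : (w @` [set` Phi]) (w a) by [exists a]; rewrite wP.
Qed.

Lemma weyl_sum w n (c : 'I_n -> R) (a : 'I_n -> V) : weyl ip Phi w ->
  w (\sum_i c i *: a i) = \sum_i c i *: w (a i).
Proof.
move=> /weyl_properties[wl _ _].
have w0 : w 0 = 0.
  by have := wl (-1) 0 0; rewrite scaler0 add0r scaleN1r addNr.
have wD u v : w (u + v) = w u + w v.
  by have := wl 1 u v; rewrite !scale1r.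
rewrite (big_morph w wD w0); apply: eq_bigr => i _.
by have := wl (c i) (a i) 0; rewrite w0 !addr0.
Qed.

Lemma weyl_eq_roots w w' : weyl ip Phi w -> weyl ip Phi w' ->
  {in Phi, w =1 w'} -> w =1 w'.
Proof.
move=> ww ww' eqw v.
have vP : v \in <<in_tuple Phi>>%VS.
  by rewrite (root_system_span Phi_root) memvf.
rewrite (coord_span vP) !weyl_sum //; apply: eq_bigr => i _.
by rewrite eqw // mem_nth.
Qed.

(* The maximum exists because [w] only matters through the self-map of the
   finite set [Phi] it induces. *)
Lemma weyl_maximizer l m : exists2 w, weyl ip Phi w &
  forall w', weyl ip Phi w' -> ip (w' l) m <= ip (w l) m.
Proof.
pose induces (s : {ffun Phi -> Phi}) w :=
  weyl ip Phi w /\ forall x : Phi, w (val x) = val (s x).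
(* A self-map [s] induced by no group element gets the default [idfun]; the predicate [P] below
   excludes such [s] from the maximum. *)
have /choice[rep repE] s : exists r, forall w, induces s w -> induces s r.
  have [[r sr]|nr] := pselect (exists r, induces s r); first by exists r.
  by exists idfun => w sw; case: nr; exists w.
have inducesP w : weyl ip Phi w -> exists s, induces s w.
  move=> ww; exists [ffun x : Phi => [` weyl_root ww (valP x)]%fset].
  by split=> // x; rewrite ffunE.
have repP s w : induces s w -> weyl ip Phi (rep s) /\ rep s l = w l.
  move=> sw; have [rw rs] := repE _ _ sw.
  split=> //; apply: weyl_eq_roots => //; first by case: sw.
  by move=> x xP; rewrite (rs [` xP]%fset) (sw.2 [` xP]%fset).
have [s0 s0P] := inducesP _ (weyl_id ip Phi).
pose P s := `[< exists w, induces s w >].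
have Ps0 : P s0 by apply/asboolP; exists idfun.
case: (Order.TotalTheory.arg_maxP (fun s => ip (rep s l) m) Ps0).
move=> s /asboolP[w sw] smax; have [rw _] := repP _ _ sw.
exists (rep s) => // w' ww'; have [s' s'w'] := inducesP _ ww'.
have [_ <-] := repP _ _ s'w'; apply: smax.
by apply/asboolP; exists w'.
Qed.

(** Replacing a maximizer [w] by [reflection ip a \o w] lowers [ip (w l) m] by
    [2 * ip (w l) a / ip a a * ip a m]. Maximality makes this nonnegative, which fixes the sign of
    [ip (w l) a]. *)
Lemma weyl_dominant l m : exists2 w, weyl ip Phi w &
  forall a, a \in Phi -> 0 < ip m a -> 0 <= ip (w l) a.
Proof.
have [w ww wmax] := weyl_maximizer l m; exists w => // a aPhi ma.
have := wmax _ (weyl_comp (weyl_refl ip aPhi) ww).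
rewrite /= /reflection linearBl /= linearZl_LR /= (dot_sym ip a m).
rewrite gerBl (pmulr_lge0 _ ma) pmulr_lge0 ?invr_gt0 ?root_gt0 //.
by rewrite pmulr_rge0.
Qed.

End Weyl.

(** * Positive systems and separation of roots *)

Section PositiveSystem.
Variables (R : realType) (V : vectType R) (ip : {dot V for idfun}).
Variables (Phi : {fset V}) (Pos : set V).
Hypotheses (Phi_root : root_system ip Phi) (Phi_pos : positive_system Phi Pos).

Lemma positive_root a : Pos a -> a \in Phi.
Proof. by case: Phi_pos => le _ -> []. Qed.

Lemma positive_or_opp (a : V) : a \in Phi -> Pos a \/ Pos (- a).
Proof.
move=> aPhi; have a0 := root_system_neq0 Phi_root aPhi.
case: Phi_pos => le lec ->; have [le_a|le_a] := boolP (le 0 a); first by left.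
right; split; [exact: (root_opp Phi_root)|by rewrite oppr_eq0|].
exact: (compatible_order_gt0N lec).
Qed.

Lemma positive_sum n (c : 'I_n -> R) (a : 'I_n -> V) :
  (forall i, 0 <= c i) -> (forall i, Pos (a i)) ->
  \sum_i c i *: a i \in Phi -> Pos (\sum_i c i *: a i).
Proof.
case: Phi_pos => le lec -> c0 aPos sPhi; split=> //.
  exact: (root_system_neq0 Phi_root sPhi).
by apply: (compatible_order_ge0_sum lec) => // i; have [] := aPos i.
Qed.

(** The order need not come from a linear functional, but [Phi] is finite, so [gordan] applies to
    the cone of nonzero nonnegative vectors. *)
Lemma positive_functional : exists m, forall a, Pos a -> 0 < ip m a.
Proof.
case: (Phi_pos) => le lec PosE.
have [m mP] : exists m, {in [seq a <- Phi | `[< Pos a >]],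
    forall v, 0 < ip m v}.
  apply: (@gordan _ _ ip [set v | v != 0 /\ le 0 v]).
  - move=> u v [u0 leu] [v0 lev]; split; last first.
      exact: (compatible_order_ge0D lec).
    apply: contra_neq u0 => /eqP; rewrite addrC addr_eq0 => /eqP vE.
    by apply: (compatible_order_ge0N lec leu); rewrite -vE.
  - move=> c u c0 [u0 leu]; split; last first.
      exact: (compatible_order_ge0Z lec (ltW c0) leu).
    by rewrite scaler_eq0 negb_or u0 gt_eqF.
  - by case; rewrite eqxx.
  - by move=> a; rewrite mem_filter => /andP[/asboolP]; rewrite PosE => -[].
exists m => a aPos; apply: mP; rewrite mem_filter positive_root // andbT.
exact/asboolP.
Qed.

Lemma cone_separation (A : set V) b : A `<=` Pos -> Pos b ->
  ~ nonneg_span A b -> exists l, ip l b < 0 /\ forall a, A a -> 0 < ip l a.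
Proof.
move=> APos bPos bA; case: (Phi_pos) => le lec PosE.
have A_ge0 u : nonneg_span A u -> le 0 u.
  move=> [n [a [c [aA c0 ->]]]]; apply: (compatible_order_ge0_sum lec) => // i.
  by have := APos _ (aA i); rewrite PosE => -[].
(* The cone generated by [A] and [- b], without the trivial combination. It omits 0: [u = c *: b]
   with [c > 0] would put [b] in the span of [A], and [c = 0] forces [u = 0]. *)
pose P := [set v | exists u (c : R),
  [/\ nonneg_span A u, 0 <= c, 0 < c \/ u != 0 & v = u - c *: b]].
have [l lP] : exists l, {in - b :: [seq a <- Phi | `[< A a >]],
    forall v, 0 < ip l v}.
  apply: (@gordan _ _ ip P).
  - move=> _ _ [u [c [uA c0 uc ->]]] [v [d [vA d0 vd ->]]].
    exists (u + v), (c + d); split; first exact: nonneg_spanD.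
    + exact: addr_ge0.
    + case: uc => [c_gt0|u0]; first by left; rewrite ltr_pwDl.
      right; apply: contra_neq u0 => /eqP; rewrite addrC addr_eq0 => /eqP vE.
      apply: (compatible_order_ge0N lec (A_ge0 _ uA)); rewrite -vE.
      exact: A_ge0.
    + by rewrite scalerDl opprD addrACA.
  - move=> k _ k0 [u [c [uA c0 uc ->]]]; exists (k *: u), (k * c); split.
    + exact: (nonneg_spanZ (ltW k0) uA).
    + exact: (mulr_ge0 (ltW k0) c0).
    + by rewrite pmulr_rgt0 // scaler_eq0 negb_or gt_eqF.
    + by rewrite scalerBr scalerA.
  - move=> [u [c [uA c0 uc /esym/eqP]]]; rewrite subr_eq0 => /eqP uE.
    case: (eqVneq c 0) uE uc => [->|cn0 uE _].
      by rewrite scale0r => ->; rewrite ltxx eqxx => -[].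
    apply: bA; rewrite -[b]scale1r -(mulVf cn0) -scalerA -uE.
    by apply: nonneg_spanZ => //; rewrite invr_ge0.
  - move=> a; rewrite inE => /predU1P[->|].
      exists 0, 1; split; [exact: nonneg_span0|by []|by left|].
      by rewrite scale1r add0r.
    rewrite mem_filter => /andP[/asboolP aA aPhi].
    exists a, 0; split; [exact: nonneg_span_sub|by []| |].
      by right; exact: (root_system_neq0 Phi_root aPhi).
    by rewrite scale0r subr0.
exists l; split=> [|a aA].
  by have := lP (- b); rewrite inE eqxx linearNr /= oppr_gt0; exact.
apply: lP; rewrite inE mem_filter positive_root ?andbT; last exact: APos.
by apply/orP; right; apply/asboolP.
Qed.

(** With [w l] nonnegative on [Pos] and [w] an isometry, the sign of [ip l] at [a] and at [b] rules
    out [- w a] and [w b] from [Pos]. *)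
Lemma weyl_separation (A : set V) b : A `<=` Pos -> Pos b ->
  ~ nonneg_span A b -> exists w, [/\ weyl ip Phi w,
    forall a, A a -> Pos (w a) & ~ Pos (w b)].
Proof.
move=> APos bPos bA; have [l [lb lA]] := cone_separation APos bPos bA.
have [m mPos] := positive_functional.
have [w ww wl] := weyl_dominant Phi_root l m.
have wl_ge0 a : Pos a -> 0 <= ip (w l) a.
  by move=> aPos; apply: wl; [exact: positive_root|exact: mPos].
have [_ wi _] := weyl_properties Phi_root ww.
exists w; split=> // [a aA|/wl_ge0]; last by rewrite wi leNgt lb.
have [//|/wl_ge0] := positive_or_opp (weyl_root Phi_root ww
  (positive_root (APos _ aA))).
by rewrite linearNr /= wi oppr_ge0 leNgt lA.
Qed.

(** The roots span more than the line of [b], so some root lies off it; up to sign it is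
    positive. *)
Lemma second_root b : (2 <= \dim (fullv : {vspace V}))%N -> Pos b ->
  exists2 a, Pos a & ~ nonneg_span [set a] b.
Proof.
move=> dimV bPos; have bPhi := positive_root bPos.
have [a aPhi ab] : exists2 a, a \in Phi & a \notin <[b]>%VS.
  apply: contrapT => nab; move: dimV; rewrite leqNgt => /negP; apply.
  rewrite ltnS (leq_trans _ (leq_b1 (b != 0))) // -dim_vline.
  apply: dimvS; rewrite -(root_system_span Phi_root).
  apply/span_subvP => a aPhi; apply: contrapT => /negP ab.
  by apply: nab; exists a.
have [a' a'Pos a'b] : exists2 a', Pos a' & a' \notin <[b]>%VS.
  by have [] := positive_or_opp aPhi; [exists a|exists (- a); rewrite ?memvN].
exists a' => // -[n [x [c [xa _ bE]]]].
have {}bE : b = (\sum_i c i) *: a'.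
  by rewrite bE scaler_suml; apply: eq_bigr => i _; rewrite (xa i).
have c0 : \sum_i c i != 0.
  apply: contra_neq (root_system_neq0 Phi_root bPhi) => c0.
  by rewrite bE c0 scale0r.
by move: a'b; rewrite -[a'](scalerK c0) -bE memvZ // memv_line.
Qed.

(** * Comparison of the two closure operators *)

Lemma cl_rho_cone (A : set V) : (2 <= \dim (fullv : {vspace V}))%N ->
  A `<=` Pos -> cl_rho ip Phi Pos A = cone Pos A.
Proof.
move=> dimV APos; apply/seteqP; split=> x.
  move=> [xPos xcl]; split=> //; apply: contrapT => xA.
  have [B [BPos AB [b bB] xB]] : exists B : set V,
      [/\ B `<=` Pos, A `<=` B, B !=set0 & ~ nonneg_span B x].
    have [A0|A0] := eqVneq A set0; last first.
      by exists A; split=> //; exact/set0P.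
    have [a aPos xa] := second_root dimV xPos.
    exists [set a]; split=> //; [by move=> _ ->|by rewrite A0|by exists a].
  have [w [ww wB wx]] := weyl_separation BPos xPos xB.
  (* The edge from [a] to [w a]; any [b] in [B] thus witnesses that [w] is a simplex of the
     punctured Weyl group. *)
  pose chain (a : V) : ('I_2 -> V) * ('I_1 -> V -> V) :=
    (fun i => if i == ord0 then a else w a, fun=> w).
  have chainP a : B a -> nerve_E ip Phi Pos (chain a).
    move=> aB; split=> //= [i|i].
      by case: ifP => _; [exact: BPos|exact: wB].
    by rewrite ord1.
  have [||e [[ePos _ /(_ ord0) eE] ew] ex] := xcl 1%N (fun=> w).
  - by exists (chain b) => //; exact: chainP.
  - by move=> a /AB aB; exists (chain a) => //; split=> //; exact: chainP.
  apply: wx; have <- : e.1 (lift ord0 ord0) = w x.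
    rewrite -eE (_ : e.2 = fun=> w) // -ex; congr (w (e.1 _)).
    exact: val_inj.
  exact: ePos.
move=> [[k [a [c [aA c0 xE]]]] xPos]; split=> // n f [g [_ gw _] gf] AD.
have fw i : weyl ip Phi (f i) by rewrite -gf; exact: gw.
have /choice[e eP] j : exists e, (nerve_E ip Phi Pos (n := n) `&`
    @rho V n @^-1` [set f]) e /\ initial_vertex e = a j.
  by have [e ? ?] := AD _ (aA j); exists e.
(* A lift of [f] starting at [x]: the combination expressing [x] in the [a j], applied vertexwise to
   the lifts starting at the [a j]. *)
pose vertex (i : 'I_n.+1) := \sum_j c j *: (e j).1 i.
have edge i : f i (vertex (widen_ord (leqnSn n) i)) = vertex (lift ord0 i).
  rewrite (weyl_sum Phi_root) //; apply: eq_bigr => j _.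
  by have [[[_ _ <-] <-] _] := eP j.
have vertex0 : vertex ord0 = x.
  by rewrite xE; apply: eq_bigr => j _; have [_ <-] := eP j.
have vertexPos i : Pos (vertex i).
  (* A nonnegative combination of positive roots is positive once it is a root; the latter
     propagates from [x] along the edges. *)
  apply: positive_sum => // [j|]; first by have [[[]]] := eP j.
  rewrite -/(vertex i); case: i; elim=> [|i IHi] ilt.
    by rewrite (_ : Ordinal ilt = ord0) ?vertex0 ?positive_root //;
      exact: val_inj.
  have -> : Ordinal ilt = lift ord0 (Ordinal (ilt : (i < n)%N)).
    exact: val_inj.
  rewrite -edge (weyl_root Phi_root) //.
  by rewrite (_ : widen_ord _ _ = Ordinal (ltnW ilt)) ?IHi //; exact: val_inj.
by exists (vertex, f).
Qed.

End PositiveSystem.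

Theorem proposition10p6 (R : realType) (V : vectType R)
    (ip : {dot V for idfun}) (Phi : {fset V}) (Pos : set V) :
  root_system ip Phi ->
  (2 <= \dim (fullv : {vspace V}))%N ->
  positive_system Phi Pos ->
  (forall A : set V, A `<=` Pos ->
     closed_for_action ip Phi Pos A <-> convex_roots Pos A) /\
  (forall A : set V, A `<=` Pos -> cl_rho ip Phi Pos A = cone Pos A).
Proof.
move=> Phi_root dimV Phi_pos; have clE := cl_rho_cone Phi_root Phi_pos dimV.
split=> // A APos; by rewrite /closed_for_action clE.
Qed.
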